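(* Let $X$ be a finite metric space and let $k\ge 0$ be an integer. The poset inclusion $\mathrm{L}_k(X)\subset\Gamma_k(X)$ has an inverse $$\max:\Gamma_k(X)\to \mathrm{L}_k(X)$$ up to homotopy, where $\max$ takes an element $(s,[x])$ to the largest layer point below it, and $\mathrm{L}_k(X)$ is a strong deformation retract of $\Gamma_k(X)$.
   Context: For a finite metric space $(X,d)$, an integer $k\ge 0$ and $s\in[0,\infty]$, the degree Rips complex $L_{s,k}(X)$ is the simplicial complex whose simplices are the non-empty subsets $\tau\subset X$ such that $d(x,x')\le s$ for all $x,x'\in\tau$ and each $x\in\tau$ has at least $k$ distinct neighbours $y\in X$ (with $y\neq x$) such that $d(x,y)\le s$. For $s\le t$ there is an inclusion $L_{s,k}(X)\subset L_{t,k}(X)$. For a vertex $x$ of $L_{s,k}(X)$, $[x]$ or $[x]_s$ denotes its path component, regarded both as an element of $\pi_0L_{s,k}(X)$ and as a subset of $X$ (the set of vertices in that component). The poset $\Gamma_k(X)$ has elements the pairs $(s,[x])$ with $s\in[0,\infty]$ and $[x]\in\pi_0L_{s,k}(X)$, with $(s,[x])\le(t,[y])$ if and only if $s\le t$ and $[x]=[y]$ in $\pi_0L_{t,k}(X)$ (equivalently $s\le t$ and $[x]_s\subset[y]_t$). A layer point of $\Gamma_k(X)$ is an element $(t,[x])$ such that either 1) whenever $(s,[y])\le(t,[x])$ with $s<t$, the set $[y]_s$ is a proper subset of $[x]_t$, or 2) there is no relation $(s,[y])\le(t,[x])$ with $s<t$. The layer points form the subposet $\mathrm{L}_k(X)\subset\Gamma_k(X)$.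 Every element of $\Gamma_k(X)$ has a unique largest layer point below it. Homotopy conventions: for poset morphisms $f,g:P\to Q$, a pointwise relation $f\le g$ (that is, $f(p)\le g(p)$ for all $p$) is a homotopy from $f$ to $g$. A subposet $\alpha:Q\subset P$ is a strong deformation retract if there is a poset morphism $\rho:P\to Q$ with $\rho\cdot\alpha=1_Q$ and a homotopy $\alpha\cdot\rho\le 1_P$ (or $1_P\le\alpha\cdot\rho$) that restricts to the identity on $Q$. *)

(* Defs.v *)
From HB Require Import structures.
From mathcomp Require Import all_boot all_order all_algebra.
From mathcomp Require Import all_classical all_reals ereal topology.

Set Implicit Arguments.
Unset Strict Implicit.
Unset Printing Implicit Defensive.

Import Order.TTheory.
Local Open Scope order_scope.

#[short(type="finMetricType")]
HB.structure Definition FinMetric (R : realType) := {X of Finite X & Metric R X}.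

Section SimplicialComplex.
Context (X : finType).

(* A finite simplicial complex on X is given by the set K of its simplices. *)
Implicit Type K : {set {set X}}.

Definition vertices K : {set X} := [set x | [set x]%SET \in K]%SET.

Definition edge K : rel X := fun x y => [set x; y]%SET \in K.

(* The path component of a vertex x, as a set of vertices: a path in the
   realization is homotopic to an edge path. *)
Definition component K (x : X) : {set X} := [set y | connect (edge K) x y]%SET.

Definition pi0 K : {set {set X}} := [set component K x | x in vertices K]%SET.

Lemma edge_sym K : symmetric (edge K).
Proof. by move=> x y; rewrite /edge finset.setUC. Qed.

Lemma component_eqP K x y :
  reflect (component K x = component K y) (connect (edge K) x y).
Proof.
have cs : connect_sym (edge K) by apply: sym_connect_sym; exact: edge_sym.
apply: (iffP idP) => [xy|/setP/(_ y)]; last by rewrite !inE connect0.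
by apply/setP => z; rewrite !inE (same_connect cs xy).
Qed.

Lemma pi0_component K C x : C \in pi0 K -> x \in C -> component K x = C.
Proof.
by move=> /imsetP[y _ ->]; rewrite inE => /component_eqP.
Qed.

Lemma pi0_neq0 K C : C \in pi0 K -> exists x, x \in C.
Proof. by move=> /imsetP[y _ ->]; exists y; rewrite inE connect0. Qed.

Lemma component_subset K K' x y : K \subset K' ->
  component K x = component K y -> component K' x = component K' y.
Proof.
move=> KK' /component_eqP xy; apply/component_eqP.
by apply: connect_sub xy => a b ab; apply: connect1; apply: (fintype.subsetP KK').
Qed.

End SimplicialComplex.

Section DegreeRips.
Context {R : realType} (X : finMetricType R) (k : nat).

Definition neighbours (s : \bar R) (x : X) : {set X} :=
  [set y | (y != x) && ((mdist x y)%:E <= s)]%SET.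

Definition degree_rips (s : \bar R) : {set {set X}} :=
  [set tau : {set X} |
    [&& tau != finset.set0,
        [forall x in tau, forall x' in tau, (mdist x x')%:E <= s] &
        [forall x in tau, (k <= #|neighbours s x|)%N]]]%SET.

Lemma degree_rips_subset s t : s <= t -> degree_rips s \subset degree_rips t.
Proof.
move=> st; apply/fintype.subsetP => tau; rewrite !inE => /and3P[-> d_tau k_tau] /=.
apply/andP; split.
  apply/forall_inP => x xt; apply/forall_inP => y yt.
  by apply: le_trans st; move/forall_inP: d_tau => /(_ x xt) /forall_inP; exact.
apply/forall_inP => x xt; move/forall_inP: k_tau => /(_ x xt) /leq_trans; apply.
apply/subset_leq_card/fintype.subsetP => y; rewrite !inE => /andP[-> /=] ys.
exact: le_trans st.
Qed.

(* The elements (s, [x]), with [x] represented by its set of vertices. *)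
Definition gamma_pred : pred (\bar R * {set X}) :=
  fun p => (0%E <= p.1) && (p.2 \in pi0 (degree_rips p.1)).

Definition gamma : Type := {p : \bar R * {set X} | gamma_pred p}.

HB.instance Definition _ := SubType.on gamma.
HB.instance Definition _ := [Choice of gamma by <:].

Definition scale (p : gamma) : \bar R := (val p).1.
Definition pcomp (p : gamma) : {set X} := (val p).2.

(* (s, [x]) <= (t, [y]) iff s <= t and [x] = [y] in pi_0 L_{t,k}(X); the choice
   of the representative x is immaterial, see gamma_leE. *)
Definition gamma_le : rel gamma := fun p q =>
  (scale p <= scale q) &&
  [exists x in pcomp p, component (degree_rips (scale q)) x == pcomp q].

Definition gamma_lt : rel gamma := fun p q => (q != p) && gamma_le p q.

Lemma pcomp_pi0 (p : gamma) : pcomp p \in pi0 (degree_rips (scale p)).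
Proof. by have /andP[] := valP p. Qed.

Lemma gamma_leE p q :
  gamma_le p q = (scale p <= scale q) && (pcomp p \subset pcomp q).
Proof.
apply/andP/andP => -[pq]; last first.
  have [x xp] := pi0_neq0 (pcomp_pi0 p) => /fintype.subsetP/(_ x xp) xq.
  split=> //; apply/exists_inP; exists x => //.
  by rewrite (pi0_component (pcomp_pi0 q) xq).
move=> /exists_inP[x xp /eqP xq]; split=> //; apply/fintype.subsetP => y yp.
rewrite -xq (@component_subset _ (degree_rips (scale p)) _ x y).
- by rewrite inE connect0.
- exact: degree_rips_subset.
- by rewrite !(pi0_component (pcomp_pi0 p)).
Qed.

Lemma gamma_lt_def p q : gamma_lt p q = (q != p) && gamma_le p q.
Proof. by []. Qed.

Lemma gamma_le_refl : reflexive gamma_le.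
Proof. by move=> p; rewrite gamma_leE lexx fintype.subxx. Qed.

Lemma gamma_le_anti : antisymmetric gamma_le.
Proof.
move=> p q; rewrite !gamma_leE => /andP[/andP[pq cpq] /andP[qp cqp]].
apply/val_inj; rewrite [LHS]surjective_pairing [RHS]surjective_pairing.
by congr pair; [apply/le_anti/andP|apply/eqP; rewrite finset.eqEsubset cpq].
Qed.

Lemma gamma_le_trans : transitive gamma_le.
Proof.
move=> q p r; rewrite !gamma_leE => /andP[pq cpq] /andP[qr cqr].
by rewrite (le_trans pq qr) (fintype.subset_trans cpq cqr).
Qed.

Fact gamma_display : Order.disp_t. Proof. exact: Order.Disp tt tt. Qed.

HB.instance Definition _ := Order.isPOrder.Build gamma_display gamma
  gamma_lt_def gamma_le_refl gamma_le_anti gamma_le_trans.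

Definition layer_point (p : gamma) : Prop :=
  (forall q : gamma, q <= p -> scale q < scale p -> pcomp q \proper pcomp p) \/
  ~ (exists q : gamma, q <= p /\ scale q < scale p).

Definition layers : Type := {p : gamma | `[< layer_point p >]}.

HB.instance Definition _ := SubType.on layers.
HB.instance Definition _ := [Choice of layers by <:].
HB.instance Definition _ :=
  [SubChoice_isSubPOrder of layers by <: with gamma_display].

Definition layer_incl : {omorphism layers -> gamma} :=
  (val : layers -> gamma) : {omorphism layers -> gamma}.

Definition is_largest_layer_below (q : layers) (p : gamma) : Prop :=
  layer_incl q <= p /\ forall q' : layers, layer_incl q' <= p -> q' <= q.

End DegreeRips.

Section Homotopy.
Context {d d' : Order.disp_t}.

Definition homotopy {P : porderType d} {Q : porderType d'}
  (f g : {omorphism P -> Q}) : Prop := forall p, f p <= g p.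

Definition homotopic {P : porderType d} {Q : porderType d'}
  (f g : {omorphism P -> Q}) : Prop := homotopy f g \/ homotopy g f.

End Homotopy.

Definition homotopy_inverse {d d'} {P : porderType d} {Q : porderType d'}
    (f : {omorphism P -> Q}) (g : {omorphism Q -> P}) : Prop :=
  homotopic (g \o f : {omorphism P -> P}) (idfun : {omorphism P -> P}) /\
  homotopic (f \o g : {omorphism Q -> Q}) (idfun : {omorphism Q -> Q}).

(* A homotopy given by a pointwise relation restricts to the identity on Q when
   its two ends agree on Q. *)
Definition strong_deformation_retract {d d'} {P : porderType d} {S : pred P}
    (Q : subPOrder S d') : Prop :=
  let alpha : {omorphism Q -> P} := (val : Q -> P) in
  exists rho : {omorphism P -> Q},
    [/\ forall q : Q, rho (alpha q) = q,
        homotopic (alpha \o rho : {omorphism P -> P})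
                  (idfun : {omorphism P -> P}) &
        forall q : Q, (alpha \o rho) (alpha q) = idfun (alpha q)].

(* Main.v *)
From HB Require Import structures.
Require Import Defs.
From mathcomp Require Import all_boot all_order all_algebra.
From mathcomp Require Import all_classical all_reals ereal topology.

(** The elements of [gamma X k] with a fixed vertex set C differ only in their
    scale.  A complex [degree_rips X k s] depends only on which distances of X
    are at most s, so it already occurs at the largest such distance
    ([degree_rips_at_distance]).  Hence every scale at which C is a path
    component dominates a distance with the same property; as X is finite, there
    is a least scale s0 at which C is a component.

    For p = (t, C), the largest layer point below p is (s0, C).  Minimality of s0
    makes it a layer point.  Conversely let (s', C') be a layer point below p with
    s0 < s'.  Components grow with the scale and C' meets C, so C is contained in
    C', whence C' = C; this contradicts the layer condition for (s', C') at its
    lower bound (s0, C).  So s' <= s0 ([exists_largest_layer_below]).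

    The rest is formal: largest layer points below elements give a monotone map
    that is the identity on layer points and lies pointwise below the identity on
    [gamma X k]; that inequality is the required homotopy. *)

Set Implicit Arguments.
Unset Strict Implicit.
Unset Printing Implicit Defensive.

Import Order.TTheory.
Local Open Scope order_scope.

Section LargestLayerPoint.
Context {R : realType} (X : finMetricType R) (k : nat).
Implicit Types (p q r : gamma X k) (s : \bar R).

(** The largest distance not exceeding s works.  The point x makes the set of
    such distances non-empty, since 0 is its distance to itself. *)
Lemma degree_rips_at_distance s (x : X) : 0%E <= s ->
  exists a b : X, (mdist a b)%:E <= s /\
    degree_rips X k (mdist a b)%:E = degree_rips X k s.
Proof.
move=> s0; pose D (u : X * X) := mdist u.1 u.2.
have xx : (D (x, x))%:E <= s by rewrite /D mdistxx.
case: (@arg_maxP _ _ _ (x, x) (fun u => (D u)%:E <= s) D xx) => -[a b] abs amax.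
exists a, b; split=> //.
have leE (u v : X) : ((mdist u v)%:E <= (mdist a b)%:E) = ((mdist u v)%:E <= s).
  apply/idP/idP => [/le_trans|uvs]; first exact.
  exact: (amax (u, v)).
apply/setP => tau; rewrite !inE; congr [&& _, _ & _].
  by apply: eq_forallb => u; congr (_ ==> _); apply: eq_forallb => v; rewrite leE.
apply: eq_forallb => u; congr (_ ==> (_ <= _)%N).
by apply: eq_card => v; rewrite !inE leE.
Qed.

(** Scales range over an infinite set, so the minimum is taken over pairs of
    points whose distance is a scale with the component [Defs.pcomp p]; every
    such scale is at least one of these distances. *)
Lemma exists_least_scale p : exists q,
  [/\ Defs.pcomp q = Defs.pcomp p, scale q <= scale p &
      forall r, Defs.pcomp r = Defs.pcomp p -> scale q <= scale r].
Proof.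
have [x _] := pi0_neq0 (pcomp_pi0 p).
pose D (u : X * X) := mdist u.1 u.2.
pose occurs u := Defs.pcomp p \in pi0 (degree_rips X k (D u)%:E).
have occurs_below r : Defs.pcomp r = Defs.pcomp p ->
    exists2 u, occurs u & (D u)%:E <= scale r.
  move=> rp; have /andP[r0 rC] := valP r.
  have [a [b [abr abE]]] := degree_rips_at_distance x r0.
  by exists (a, b) => //; rewrite /occurs /D abE -rp.
have [u0 u0C _] := occurs_below p erefl.
case: (@arg_minP _ _ _ u0 occurs D u0C) => u uC umin.
have uP : gamma_pred k ((D u)%:E, Defs.pcomp p).
  by apply/andP; split=> //=; rewrite lee_fin mdist_ge0.
pose q : gamma X k := Sub ((D u)%:E, Defs.pcomp p) uP.
have qmin r : Defs.pcomp r = Defs.pcomp p -> scale q <= scale r.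
  by move=> /occurs_below[v vC]; apply: le_trans; rewrite lee_fin umin.
by exists q; split=> //; apply: qmin.
Qed.

(** The element with the vertex set of p and the least scale is a layer point
    because nothing strictly lower has the same vertex set.  A layer point below p
    with a larger scale would lie above it without having a larger vertex set. *)
Lemma exists_largest_layer_below p :
  exists q : layers X k, is_largest_layer_below q p.
Proof.
have [q [qC qp qmin]] := exists_least_scale p.
have q_layer : layer_point q.
  left=> r; rewrite [r <= q]gamma_leE => /andP[_ rq] ltrq.
  rewrite finset.properEneq rq andbT; apply/eqP => rqC.
  by have := qmin r (etrans rqC qC); rewrite leNgt ltrq.
exists (Sub q (asboolT q_layer)); split.
  by rewrite /= [_ <= _]gamma_leE qp qC /=.
move=> q' /=; rewrite [_ <= p]gamma_leE => /andP[_ q'p].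
change (val q' <= q); rewrite [_ <= _]gamma_leE qC q'p andbT leNgt.
apply/negP => ltqq'.
(* A common vertex identifies the components at the larger scale. *)
have le_qq' : q <= val q'.
  have [x xq'] := pi0_neq0 (pcomp_pi0 (val q')).
  apply/andP; split; first exact: ltW.
  apply/exists_inP; exists x; last by rewrite (pi0_component (pcomp_pi0 _) xq').
  by rewrite qC; apply: (fintype.subsetP q'p).
have /asboolP[/(_ q le_qq' ltqq')|] := valP q'; last by apply; exists q.
by rewrite qC properE q'p andbF.
Qed.

Definition max_layer p : layers X k := projT1 (cid (exists_largest_layer_below p)).

Lemma max_layerP p : is_largest_layer_below (max_layer p) p.
Proof. by rewrite /max_layer; case: cid. Qed.

Lemma max_layer_homo : {homo max_layer : p q / p <= q}.
Proof.
move=> p q pq; have [_ qmax] := max_layerP q; have [pp _] := max_layerP p.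
by apply: qmax; apply: le_trans pq.
Qed.

HB.instance Definition _ :=
  Order.isOrderMorphism.Build _ (gamma X k) _ (layers X k) max_layer
    max_layer_homo.

Lemma max_layer_id (q : layers X k) : max_layer (val q) = q.
Proof.
have [le_q qmax] := max_layerP (val q).
by apply/le_anti/andP; split; [exact: le_q | apply: qmax; exact: lexx].
Qed.

Lemma max_layer_le p : val (max_layer p) <= p.
Proof. by have [] := max_layerP p. Qed.

End LargestLayerPoint.

Theorem lemma6 (R : realType) (X : finMetricType R) (k : nat) :
  (exists max : {omorphism gamma X k -> layers X k},
     (forall p : gamma X k, is_largest_layer_below (max p) p) /\
     homotopy_inverse (layer_incl X k) max) /\
  strong_deformation_retract (layers X k).
Proof.
pose max : {omorphism gamma X k -> layers X k} := @max_layer R X k.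
split; exists max.
  split; first exact: max_layerP.
  split; left=> p /=; first by rewrite max_layer_id.
  exact: max_layer_le.
split=> [q||q] /=; first exact: max_layer_id.
  by left=> p /=; exact: max_layer_le.
by rewrite max_layer_id.
Qed.
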